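(* Let $n\ge5$ and let $D$ be an $n\times n$ Euclidean distance matrix with embedding dimension $r=3$, with generating points $p^1,\ldots,p^n\in\mathbb{R}^r$ affinely spanning $\mathbb{R}^r$ and satisfying $\sum_{i=1}^n p^i=\mathbf{0}$. Let $P$ be the $n\times r$ matrix whose $i$-th row is $(p^i)^T$, and let $b=\mathrm{diag}(PP^T)$. Let $d^m\in\mathbb{R}^n$. If $x^*$ is an optimal solution of the unconstrained problem $$\min_{x\in\mathbb{R}^r}\ \frac{n}{16}(x^Tx)^2+x^TP^TPx+\frac12\,(x^Tx)\,e^T(b-d^m)+2x^TP^T(b-d^m),$$ then $$y^*=Px^*+\frac14({x^*}^Tx^* )\,e+b$$ is an optimal solution of the problem $$\min_{y\in\mathbb{R}^n}\ \|y-d^m\|^2\quad\text{subject to}\quad\begin{bmatrix}0&y^T\\ y&D\end{bmatrix}\text{ is an EDM of embedding dimension }r.$$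
   Context: An $n\times n$ matrix $D=(d_{ij})$ is a Euclidean distance matrix (EDM) if there are points $p^1,\ldots,p^n$ (generating points of $D$) in some Euclidean space with $d_{ij}=\|p^i-p^j\|^2$ for all $i,j$; the dimension of their affine span is the embedding dimension of $D$. Here $e$ is the all-ones vector, $\mathrm{diag}(A)$ the vector of diagonal entries of $A$, and $\|\cdot\|$ the Euclidean norm. *)

(* Defs.v *)
From mathcomp Require Import all_boot all_order all_algebra.
From mathcomp Require Import reals.
Set Implicit Arguments.
Unset Strict Implicit.
Unset Printing Implicit Defensive.
Import GRing.Theory Num.Theory.
Local Open Scope ring_scope.

Definition dot (R : realType) (n : nat) (u v : 'cV[R]_n) : R :=
  (u^T *m v) 0 0.

(* The norm `|_| that MathComp-Analysis puts on matrices is the sup norm. *)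
Definition enorm (R : realType) (n : nat) (u : 'cV[R]_n) : R :=
  Num.sqrt (dot u u).

Definition ones (R : realType) (n : nat) : 'cV[R]_n := const_mx 1.

Definition diag_vec (R : realType) (n : nat) (A : 'M[R]_n) : 'cV[R]_n :=
  \col_i A i i.

Definition generates (R : realType) (n k : nat)
    (p : 'I_n -> 'cV[R]_k) (D : 'M[R]_n) : Prop :=
  forall i j, D i j = enorm (p i - p j) ^+ 2.

(* The dimension of an affine subspace is that of its direction, which for the
   affine span of the points p i is the linear span of their differences. *)
Definition aff_dim (R : realType) (n k : nat) (p : 'I_n -> 'cV[R]_k) : nat :=
  \dim <<[seq p i - p j | i <- enum 'I_n, j <- enum 'I_n]>>%VS.

Definition affinely_spans (R : realType) (n k : nat)
    (p : 'I_n -> 'cV[R]_k) : Prop :=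
  forall x : 'cV[R]_k, exists w : 'I_n -> R,
    \sum_i w i = 1 /\ x = \sum_i w i *: p i.

(* The ambient dimension k is arbitrary; all generating configurations of D
   are congruent, so r does not depend on the one chosen. *)
Definition edm_of_dim (R : realType) (n r : nat) (D : 'M[R]_n) : Prop :=
  exists (k : nat) (p : 'I_n -> 'cV[R]_k), generates p D /\ aff_dim p = r.

Definition optimal (R : realType) (T : Type) (S : T -> Prop) (f : T -> R)
    (x : T) : Prop :=
  S x /\ forall x', S x' -> f x <= f x'.

(* Main.v *)
(** With the substitution [x = -2a], the vector [P x + (x^T x / 4) e + b] has
    entries [|p i - a|^2], and its squared distance to [dm] is the objective
    plus the constant [|b - dm|^2]; the cross term with [e^T P x] vanishes
    because the points are centred.  It remains to see that the feasible set
    consists exactly of the vectors [(|p i - a|^2)_i].  If [q] generates the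
    bordered matrix, then [q i] and [p i] have the same mutual distances, so
    [\sum c_i (p i - p i0)] and [\sum c_i (q i - q i0)] always have the same
    norm.  Hence the differences [q i - q i0] span a space of dimension 3, the
    whole direction space of [q]: the extra point is an affine combination of
    the [q i], and the same combination of the [p i] is the point [a]. *)
Require Import Defs.
From mathcomp Require Import all_boot all_order all_algebra.
From mathcomp Require Import reals.
From HB Require Import structures.
From mathcomp Require Import ring.
Set Implicit Arguments.
Unset Strict Implicit.
Unset Printing Implicit Defensive.
Import GRing.Theory Num.Theory.
Local Open Scope ring_scope.

Section Dot.
Variables (R : realType) (n : nat).
Implicit Types (u v w : 'cV[R]_n) (a : R).

Lemma dotE u v : dot u v = \sum_i u i 0 * v i 0.
Proof. by rewrite /dot mxE; apply: eq_bigr => i _; rewrite mxE. Qed.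

Lemma dotC u v : dot u v = dot v u.
Proof. by rewrite !dotE; apply: eq_bigr => i _; rewrite mulrC. Qed.

Lemma dotDl u v w : dot (u + v) w = dot u w + dot v w.
Proof. by rewrite /dot linearD mulmxDl mxE. Qed.

Lemma dotZl a u w : dot (a *: u) w = a * dot u w.
Proof. by rewrite /dot linearZ -scalemxAl mxE. Qed.

Lemma dotNl u w : dot (- u) w = - dot u w.
Proof. by rewrite -scaleN1r dotZl mulN1r. Qed.

Lemma dotDr u v w : dot w (u + v) = dot w u + dot w v.
Proof. by rewrite dotC dotDl !(dotC w). Qed.

Lemma dotZr a u w : dot w (a *: u) = a * dot w u.
Proof. by rewrite dotC dotZl (dotC w). Qed.

Lemma dotNr u w : dot w (- u) = - dot w u.
Proof. by rewrite dotC dotNl (dotC w). Qed.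

Lemma dot_suml I (s : seq I) (F : I -> 'cV[R]_n) w :
  dot (\sum_(i <- s) F i) w = \sum_(i <- s) dot (F i) w.
Proof. by rewrite /dot linear_sum mulmx_suml summxE. Qed.

Lemma dot_sumr I (s : seq I) (F : I -> 'cV[R]_n) w :
  dot w (\sum_(i <- s) F i) = \sum_(i <- s) dot w (F i).
Proof. by rewrite dotC dot_suml; apply: eq_bigr => i _; rewrite dotC. Qed.

Lemma dot_ge0 u : 0 <= dot u u.
Proof. by rewrite dotE sumr_ge0 // => i _; rewrite -expr2 sqr_ge0. Qed.

Lemma dot_eq0 u : (dot u u == 0) = (u == 0).
Proof.
apply/eqP/eqP => [|->]; last by rewrite /dot mulmx0 mxE.
rewrite dotE => /eqP; rewrite psumr_eq0; last first.
  by move=> i _; rewrite -expr2 sqr_ge0.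
move=> /allP u0; apply/colP => i; rewrite mxE; apply/eqP.
by have := u0 i (mem_index_enum i); rewrite -expr2 sqrf_eq0.
Qed.

Lemma enorm_sqr u : enorm u ^+ 2 = dot u u.
Proof. by rewrite sqr_sqrtr // dot_ge0. Qed.

End Dot.

Lemma dot_mulmx (R : realType) m n (A : 'M[R]_(m, n)) (u : 'cV[R]_m) v :
  dot v (A^T *m u) = dot (A *m v) u.
Proof. by rewrite /dot trmx_mul mulmxA. Qed.

Lemma dot_ones (R : realType) n (u : 'cV[R]_n) : dot (ones R n) u = \sum_i u i 0.
Proof. by rewrite dotE; apply: eq_bigr => i _; rewrite mxE mul1r. Qed.

Lemma same_gram_dot_sum (R : realType) n r k (v : 'I_n -> 'cV[R]_r)
    (w : 'I_n -> 'cV[R]_k) (c d : 'I_n -> R) :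
  (forall i j, dot (v i) (v j) = dot (w i) (w j)) ->
  dot (\sum_i c i *: v i) (\sum_i d i *: v i) =
  dot (\sum_i c i *: w i) (\sum_i d i *: w i).
Proof.
move=> gram; rewrite !dot_suml; apply: eq_bigr => i _.
rewrite !dot_sumr; apply: eq_bigr => j _.
by rewrite !dotZl !dotZr gram.
Qed.

(** Coefficients form a row vector so that the domain is a finite-dimensional vector space, where
    kernel and image dimensions can be compared. *)
Definition lincomb (R : realType) n k (v : 'I_n -> 'cV[R]_k) (c : 'rV[R]_n) :=
  \sum_i c 0 i *: v i.

Lemma lincomb_is_linear (R : realType) n k (v : 'I_n -> 'cV[R]_k) :
  linear (lincomb v).
Proof.
move=> a c d; rewrite /lincomb scaler_sumr -big_split /=.
by apply: eq_bigr => i _; rewrite !mxE scalerDl scalerA.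
Qed.

HB.instance Definition _ (R : realType) n k (v : 'I_n -> 'cV[R]_k) :=
  GRing.isLinear.Build R 'rV[R]_n 'cV[R]_k _ (lincomb v) (lincomb_is_linear v).

(* Equal Gram matrices give the maps [c |-> \sum c_i v_i] and
   [c |-> \sum c_i w_i] the same kernel, hence images of the same dimension. *)
Lemma same_gram_span (R : realType) n r k (v : 'I_n -> 'cV[R]_r)
    (w : 'I_n -> 'cV[R]_k) (U : {vspace 'cV[R]_k}) :
  (forall i j, dot (v i) (v j) = dot (w i) (w j)) ->
  (forall x, exists c : 'I_n -> R, x = \sum_i c i *: v i) ->
  (forall i, w i \in U) -> \dim U = r ->
  forall u, u \in U -> exists c : 'I_n -> R, u = \sum_i c i *: w i.
Proof.
move=> gram vspan wU dimU u uU.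
pose phi := linfun (lincomb v); pose psi := linfun (lincomb w).
(* A combination vanishes exactly when its squared norm does, and the Gram matrix determines that
   norm. *)
have ker_eq : lker phi = lker psi.
  apply/vspaceP => c; rewrite !memv_ker !lfunE /= -!dot_eq0.
  by rewrite (same_gram_dot_sum _ _ gram).
have phi_full : limg phi = fullv.
  apply/vspaceP => x; rewrite memvf; have [c ->] := vspan x.
  have -> : \sum_i c i *: v i = phi (\row_i c i).
    by rewrite lfunE; apply: eq_bigr => i _; rewrite mxE.
  by rewrite memv_img ?memvf.
have psi_sub : (limg psi <= U)%VS.
  apply/subvP => _ /memv_imgP[c _ ->]; rewrite lfunE.
  by apply: memv_suml => i _; rewrite memvZ.
have dim_psi : \dim (limg psi) = r.
  have := limg_ker_dim phi fullv; rewrite -(limg_ker_dim psi fullv) ker_eq.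
  by move/addnI <-; rewrite phi_full dimvf /dim /= muln1.
have : u \in limg psi.
  by have /eqP-> : limg psi == U by rewrite eqEdim psi_sub dim_psi dimU /=.
by case/memv_imgP => c _ ->; rewrite lfunE; exists (c 0).
Qed.

Lemma affinely_spans_differences (R : realType) n k (p : 'I_n -> 'cV[R]_k) i0 :
  affinely_spans p ->
  forall x, exists c : 'I_n -> R, x = \sum_i c i *: (p i - p i0).
Proof.
(* Since the weights of [x + p i0] sum to 1, subtracting [p i0] from each point leaves exactly
   [x]. *)
move=> pspan x; have [c [c1 xE]] := pspan (x + p i0); exists c.
under eq_bigr do rewrite scalerBr.
by rewrite sumrB -xE -scaler_suml c1 scale1r addrK.
Qed.

Lemma mem_differences (R : realType) n k (p : 'I_n -> 'cV[R]_k) i j :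
  p i - p j \in <<[seq p i - p j | i <- enum 'I_n, j <- enum 'I_n]>>%VS.
Proof. by apply/memv_span/allpairs_f; rewrite mem_enum. Qed.

Lemma affinely_spans_aff_dim (R : realType) n k (p : 'I_n.+1 -> 'cV[R]_k) :
  affinely_spans p -> aff_dim p = k.
Proof.
move=> pspan; rewrite /aff_dim; set U := <<_>>%VS.
suff -> : U = fullv by rewrite dimvf /dim /= muln1.
apply/vspaceP => x; rewrite memvf.
have [c ->] := affinely_spans_differences ord0 pspan x.
by apply: memv_suml => i _; rewrite memvZ ?mem_differences.
Qed.

(** Polarization: the right-hand side involves [D] only, so any two configurations generating [D]
    have the same Gram matrix of differences. *)
Lemma dot_differences (R : realType) n k (D : 'M[R]_n) (p : 'I_n -> 'cV[R]_k) h :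
  generates p D ->
  forall i j, dot (p i - p h) (p j - p h) = (D i h + D j h - D i j) / 2%:R.
Proof.
move=> hp i j; rewrite !hp !enorm_sqr !(dotDl, dotNl, dotDr, dotNr).
rewrite (dotC (p h) (p i)) (dotC (p h) (p j)) (dotC (p j) (p i)).
by field.
Qed.

Section BorderedEDM.
Variables (R : realType) (n r : nat) (D : 'M[R]_n) (p : 'I_n -> 'cV[R]_r).
Hypotheses (hp : generates p D) (hspan : affinely_spans p).

Lemma edm_of_dim_block (y : 'cV[R]_n) (a : 'cV[R]_r) :
  (forall i, y i 0 = dot (p i - a) (p i - a)) ->
  edm_of_dim r (block_mx 0 y^T y D : 'M[R]_(1 + n)).
Proof.
move=> yE.
pose q (i : 'I_(1 + n)) := if split i is inr j then p j else a.
have ql i : q (lshift n i) = a.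
  by rewrite /q (unsplitK (inl i : 'I_1 + 'I_n)).
have qr i : q (rshift 1 i) = p i.
  by rewrite /q (unsplitK (inr i : 'I_1 + 'I_n)).
have qspan : affinely_spans q.
  move=> x; have [c [c1 ->]] := hspan x.
  (* The added point [a] gets weight 0, so affine combinations of [p] carry over to [q]. *)
  exists (fun i : 'I_(1 + n) => if split i is inr j then c j else 0).
  rewrite !big_split_ord /= !big_ord1.
  split; [rewrite -c1|]; rewrite (unsplitK (inl ord0 : 'I_1 + 'I_n)).
    rewrite add0r; apply: eq_bigr => i _.
    by rewrite (unsplitK (inr i : 'I_1 + 'I_n)).
  rewrite scale0r add0r; apply: eq_bigr => i _.
  by rewrite (unsplitK (inr i : 'I_1 + 'I_n)) qr.
exists r, q; split; last exact: affinely_spans_aff_dim qspan.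
move=> i j; rewrite enorm_sqr.
case: (split_ordP i) => i' ->; case: (split_ordP j) => j' ->; rewrite ?ql ?qr.
- by rewrite block_mxEul mxE subrr /dot mulmx0 mxE.
- by rewrite block_mxEur mxE ord1 yE -(opprB (p j')) dotNl dotNr opprK.
- by rewrite block_mxEdl ord1 yE.
- by rewrite block_mxEdr hp enorm_sqr.
Qed.

Lemma edm_of_dim_blockP (i0 : 'I_n) (y : 'cV[R]_n) :
  edm_of_dim r (block_mx 0 y^T y D : 'M[R]_(1 + n)) ->
  exists a, forall i, y i 0 = dot (p i - a) (p i - a).
Proof.
move=> [k [q [hq qdim]]].
pose s i := q (rshift 1 i); pose z := q (lshift n ord0).
have hs : generates s D by move=> i j; rewrite -hq block_mxEdr.
have yE i : y i 0 = dot (s i - z) (s i - z).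
  by rewrite -enorm_sqr -hq block_mxEdl.
have gram i j : dot (p i - p i0) (p j - p i0) = dot (s i - s i0) (s j - s i0).
  by rewrite (dot_differences _ hp) (dot_differences _ hs).
(* [U] is the direction space of all of [q], of dimension [r] by [qdim]; it contains [z - s i0] as
   well as the differences of [s]. *)
have [c zE] : exists c : 'I_n -> R, z - s i0 = \sum_i c i *: (s i - s i0).
  apply: (same_gram_span gram (affinely_spans_differences i0 hspan) _ qdim).
    by move=> i; exact: (mem_differences q).
  exact: (mem_differences q).
exists (p i0 + \sum_i c i *: (p i - p i0)) => j.
(* Written as one combination of differences, with the same coefficients for [p] and [s], the vector
   has a norm fixed by the common Gram matrix. *)
have diffE m (t : 'I_n -> 'cV[R]_m) :
    t j - t i0 - \sum_i c i *: (t i - t i0) =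
    \sum_i ((i == j)%:R - c i) *: (t i - t i0).
  under [RHS]eq_bigr do rewrite scalerBl.
  rewrite sumrB; congr (_ - _).
  rewrite (bigD1 j) //= eqxx scale1r big1 ?addr0 // => i /negPf->.
  by rewrite scale0r.
have szE : s j - z = \sum_i ((i == j)%:R - c i) *: (s i - s i0).
  by rewrite -diffE -zE opprB addrA subrK.
by rewrite yE szE opprD addrA diffE (same_gram_dot_sum _ _ gram).
Qed.

End BorderedEDM.

Theorem mainTheorem4 (R : realType) (n : nat) (hn : (5 <= n)%N)
    (D : 'M[R]_n) (hD : edm_of_dim 3 D)
    (p : 'I_n -> 'cV[R]_3) (hp : generates p D)
    (hspan : affinely_spans p) (hcenter : \sum_i p i = 0)
    (dm : 'cV[R]_n) (xs : 'cV[R]_3) :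
  let P : 'M[R]_(n, 3) := \matrix_(i < n) (p i)^T in
  let b : 'cV[R]_n := diag_vec (P *m P^T) in
  let e : 'cV[R]_n := ones R n in
  optimal (fun _ : 'cV[R]_3 => True)
    (fun x : 'cV[R]_3 =>
       n%:R / 16%:R * dot x x ^+ 2
       + dot x (P^T *m P *m x)
       + 1 / 2%:R * dot x x * dot e (b - dm)
       + 2%:R * dot x (P^T *m (b - dm)))
    xs ->
  optimal (fun y : 'cV[R]_n => edm_of_dim 3 (block_mx 0 y^T y D : 'M[R]_(1 + n)))
    (fun y : 'cV[R]_n => enorm (y - dm) ^+ 2)
    (P *m xs + (1 / 4%:R * dot xs xs) *: e + b).
Proof.
move=> P b e [_ xs_min].
pose Y (x : 'cV[R]_3) : 'cV[R]_n := P *m x + (1 / 4%:R * dot x x) *: e + b.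
have PxE x i : (P *m x) i 0 = dot (p i) x.
  by rewrite mxE dotE; apply: eq_bigr => j _; rewrite !mxE.
have bE i : b i 0 = dot (p i) (p i).
  by rewrite !mxE dotE; apply: eq_bigr => j _; rewrite !mxE.
have YE x i : Y x i 0 =
    dot (p i - (- 1 / 2%:R) *: x) (p i - (- 1 / 2%:R) *: x).
  rewrite 2!mxE PxE bE !mxE !(dotDl, dotNl, dotDr, dotNr, dotZl, dotZr).
  by rewrite (dotC x (p i)); field.
have eP x : dot e (P *m x) = 0.
  rewrite dot_ones; under eq_bigr do rewrite PxE.
  by rewrite -dot_suml hcenter /dot trmx0 mul0mx mxE.
(* Together with the square of 1/4, this yields the coefficient [n / 16] of the quartic term. *)
have ee : dot e e = n%:R.
  by rewrite dot_ones; under eq_bigr do rewrite mxE; rewrite sumr_const card_ord.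
have objE x : enorm (Y x - dm) ^+ 2 =
    n%:R / 16%:R * dot x x ^+ 2 + dot x (P^T *m P *m x)
    + 1 / 2%:R * dot x x * dot e (b - dm) + 2%:R * dot x (P^T *m (b - dm))
    + dot (b - dm) (b - dm).
  rewrite enorm_sqr /Y -addrA -mulmxA !dot_mulmx.
  (* Abstracting [b - dm] keeps the bilinear expansion from splitting it. *)
  move: (b - dm) => g; rewrite !(dotDl, dotDr, dotZl, dotZr).
  rewrite (dotC (P *m x) e) eP ee (dotC g (P *m x)) (dotC g e).
  by field.
split=> [|y].
  exact: (edm_of_dim_block hp hspan (YE xs)).
case/(edm_of_dim_blockP hp hspan (Ordinal (leq_trans (isT : 0 < 5)%N hn))) => a yE.
(* Inverts the substitution, so that [xs] can be compared with the unconstrained point [-2a]. *)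
have -> : y = Y (- 2%:R *: a).
  apply/colP => i; rewrite yE YE scalerA.
  have -> : - 1 / 2%:R * - 2%:R = 1 :> R by field.
  by rewrite scale1r.
(* The constant [dot (b - dm) (b - dm)] occurs on both sides and cancels. *)
by rewrite -[P *m xs + _ + _]/(Y xs) !objE lerD2r xs_min.
Qed.
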